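(* Let $(\mathcal X_+,\mathcal X_0,\mathcal X_-)$ be a quasi Gelfand triple with embeddings $\iota_+,\iota_-$, and let $D_+=\operatorname{ran}\iota_+$, $D_-=\operatorname{ran}\iota_-$. Then $D_+\cap D_-$ is dense in $\mathcal X_0$ with respect to $\|\cdot\|_{\mathcal X_0}$.
   Context: All spaces are complex; the anti-dual $X'$ of a Banach space $X$ is the space of continuous antilinear functionals on $X$. For Banach spaces $X,Y$ and a continuous sesquilinear form $\langle\cdot,\cdot\rangle_{Y,X}:Y\times X\to\mathbb C$ (linear in the first, antilinear in the second argument), put $\langle x,y\rangle_{X,Y}:=\overline{\langle y,x\rangle_{Y,X}}$. $(X,Y)$ is a complete dual pair if $Y\to X'$, $y\mapsto\langle y,\cdot\rangle_{Y,X}$ and $X\to Y'$, $x\mapsto\langle x,\cdot\rangle_{X,Y}$ are both isometric and bijective. A pre-quasi Gelfand triple $(\mathcal X_+,\mathcal X_0,\mathcal X_-)$ consists of a complete dual pair $(\mathcal X_+,\mathcal X_-)$ of Banach spaces, a Hilbert space $\mathcal X_0$ and linear maps $\iota_\pm:\operatorname{dom}\iota_\pm\subseteq\mathcal X_\pm\to\mathcal X_0$ that are densely defined, closed, injective and have dense range, with $\langle g,f\rangle_{\mathcal X_-,\mathcal X_+}=\langle\iota_-g,\iota_+f\rangle_{\mathcal X_0}$ for all $f\in\operatorname{dom}\iota_+$, $g\in\operatorname{dom}\iota_-$. It is a quasi Gelfand triple if in addition $\operatorname{dom}\iota_+^*=\operatorname{ran}\iota_-$, where $\operatorname{dom}\iota_+^*$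 is the set of $h\in\mathcal X_0$ for which $\operatorname{dom}\iota_+\ni f\mapsto\langle h,\iota_+f\rangle_{\mathcal X_0}$ is continuous with respect to $\|\cdot\|_{\mathcal X_+}$. *)

(* Defs.v *)
From HB Require Import structures.
From mathcomp Require Import all_boot all_order all_algebra.
From mathcomp Require Import complex.
From mathcomp Require Import all_classical all_reals all_analysis.

Set Implicit Arguments.
Unset Strict Implicit.
Unset Printing Implicit Defensive.

Import Order.TTheory GRing.Theory Num.Theory Num.Def.
Import numFieldNormedType.Exports.

Local Open Scope classical_set_scope.
Local Open Scope complex_scope.
Local Open Scope ring_scope.

(* The norm of a [normedModType R[i]] takes its values in [R[i]] (they are
   nonnegative, hence real); a complex Banach space is a
   [completeNormedModType R[i]].  Sesquilinear forms are linear in the first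
   argument and antilinear in the second one. *)

Notation "{ 'sesquilinear' Y -> X -> C }" :=
  {bilinear Y -> X -> C | *%R & (conjC \; *%R)}
  (at level 0, Y at level 98, X at level 98, C at level 99,
   only parsing) : ring_scope.

Section Antidual.
Variables (R : realType) (X : normedModType R[i]).

Definition antidual : set (X -> R[i]) :=
  [set phi | linear_for (conjC \; *%R) phi /\
             continuous (phi : X -> R[i]^o)].

(* [sup] is meaningful on [antidual]: there the set is bounded. *)
Definition antidual_norm (phi : X -> R[i]) : R[i] :=
  (sup [set complex.Re `|phi x| | x in [set x : X | `|x| <= 1]])%:C.

End Antidual.

Definition isometric_bijection_antidual (R : realType)
    (X Y : normedModType R[i]) (F : Y -> X -> R[i]) : Prop :=
  set_bij setT (antidual (X := X)) F /\
  (forall y, antidual_norm (F y) = `|y|).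

Record complete_dual_pair (R : realType) (X Y : completeNormedModType R[i])
    (form : {sesquilinear Y -> X -> R[i]}) : Prop := CompleteDualPair {
  form_continuous : continuous (fun p : Y * X => form p.1 p.2 : R[i]^o);
  form_antidual_left :
    isometric_bijection_antidual (fun (y : Y) (x : X) => form y x);
  form_antidual_right :
    isometric_bijection_antidual (fun (x : X) (y : Y) => conjC (form y x))
}.

(* Together with the completeness of [H], this makes [H] a Hilbert space. *)
Definition inner_product_of_norm (R : realType) (H : normedModType R[i])
    (ip : {dot H for conjC}) : Prop :=
  forall x : H, ip x x = `|x| ^+ 2.

(* A linear map defined on a linear subspace [dom] of [X]; the values of
   [opfun] outside [dom] are irrelevant. *)
Record operator (R : realType) (X Y : normedModType R[i]) := Operator {
  dom : set X;
  opfun :> X -> Y;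
  dom0 : dom 0;
  domP : forall (a : R[i]) (x y : X), dom x -> dom y -> dom (a *: x + y);
  opfunP : forall (a : R[i]) (x y : X), dom x -> dom y ->
    opfun (a *: x + y) = a *: opfun x + opfun y
}.

Section Operators.
Variables (R : realType) (X Y : normedModType R[i]) (T : operator X Y).

Definition ran : set Y := T @` dom T.

Definition graph : set (X * Y) := [set p | dom T p.1 /\ p.2 = T p.1].

Record embedding : Prop := Embedding {
  densely_defined : dense (dom T);
  closed_graph : closed graph;
  inj_on_dom : set_inj (dom T) T;
  dense_range : dense ran
}.

Definition adjoint_dom (ip : {dot Y for conjC}) : set Y :=
  [set h | {within dom T, continuous (fun f => ip h (T f) : R[i]^o)}].

End Operators.

Section QuasiGelfandTriple.
Variables (R : realType) (Xp X0 Xm : completeNormedModType R[i]).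
Variables (pairing : {sesquilinear Xm -> Xp -> R[i]}).
Variables (ip : {dot X0 for conjC}).
Variables (iotap : operator Xp X0) (iotam : operator Xm X0).

Record pre_quasi_Gelfand_triple : Prop := PreQuasiGelfandTriple {
  pqg_dual_pair : complete_dual_pair pairing;
  pqg_Hilbert : inner_product_of_norm ip;
  pqg_embp : embedding iotap;
  pqg_embm : embedding iotam;
  pqg_pairing : forall f g, dom iotap f -> dom iotam g ->
    pairing g f = ip (iotam g) (iotap f)
}.

Definition quasi_Gelfand_triple : Prop :=
  pre_quasi_Gelfand_triple /\ adjoint_dom iotap ip = ran iotam.

End QuasiGelfandTriple.

(* Main.v *)
Require Import Defs.
From mathcomp Require Import all_boot all_order all_algebra.
From mathcomp Require Import complex.
From mathcomp Require Import all_classical all_reals all_analysis.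
From mathcomp Require Import ring lra.

Set Implicit Arguments.
Unset Strict Implicit.
Unset Printing Implicit Defensive.

Import Order.TTheory GRing.Theory Num.Theory Num.Def.
Import numFieldNormedType.Exports.

Local Open Scope classical_set_scope.
Local Open Scope complex_scope.
Local Open Scope ring_scope.

(* Given f in D_+ and e > 0, let K be the closed convex set of all y with
   |<iota_- u, y>| <= e |u| for u in dom iota_-, and let y be the orthogonal
   projection of f onto K. Since K contains the image under iota_+ of a ball of
   X_+, the variational inequality for y says that iota_+^* is defined at f - y,
   so f - y lies in D_-. On the other hand y lies in D_+: the pairing represents
   the functional u |-> <iota_- u, y> by some x in X_+, and (x, y) lies in the
   graph of iota_+ by Hahn-Banach, that graph being closed. Hence f - y lies in
   the intersection of D_+ and D_-. Finally |y|^2 <= Re <f, y>, and approximating f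
   by elements of D_- shows that y tends to 0 with e. *)

(** * Sublinear functionals and the real Hahn-Banach theorem *)

Section SublinearFunctionals.
Variables (R : realType) (V : lmodType R[i]).
Implicit Types (p q : V -> R) (x y z : V).

(** Homogeneity is only an inequality for positive [t], which infima satisfy readily; using it for
    [t^-1] as well gives equality. *)
Definition sublinear p : Prop :=
  (forall x y, p (x + y) <= p x + p y) /\
  (forall (t : R) x, 0 < t -> p (t%:C *: x) <= t * p x).

Lemma sublinear0 p : sublinear p -> p 0 = 0.
Proof.
move=> [_ pZ]; have := pZ 2 0; have := pZ 2^-1 0.
rewrite !scaler0 invr_gt0 ltr0n => /(_ isT) ? /(_ isT); lra.
Qed.

Lemma sublinearZ p (t : R) x : sublinear p -> 0 <= t ->
  p (t%:C *: x) = t * p x.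
Proof.
move=> pS; rewrite le_eqVlt => /predU1P[<-|t0].
  by rewrite scale0r mul0r sublinear0.
apply/eqP; rewrite eq_le (pS.2 _ _ t0) /=.
have := pS.2 t^-1 (t%:C *: x); rewrite invr_gt0 => /(_ t0).
rewrite scalerA -rmorphM /= mulVf ?gt_eqF// scale1r.
by rewrite -(ler_pM2l t0) mulVKf ?gt_eqF.
Qed.

Lemma sublinearN p x : sublinear p -> - p (- x) <= p x.
Proof.
by move=> pS; have := pS.1 x (- x); rewrite subrr sublinear0//; lra.
Qed.

Definition pointwise_inf {I : Type} (A : set I) (h : I -> V -> R) x : R :=
  inf [set h i x | i in A].

Section Infimum.
Variables (I : Type) (A : set I) (h : I -> V -> R).
Hypothesis h_lb : forall x, exists m, forall i, A i -> m <= h i x.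

Lemma pointwise_inf_le i x : A i -> pointwise_inf A h x <= h i x.
Proof.
move=> Ai; apply: ge_inf; last by exists i.
by have [m hm] := h_lb x; exists m => _ [j Aj <-]; exact: hm.
Qed.

Lemma le_pointwise_inf m x : A !=set0 -> (forall i, A i -> m <= h i x) ->
  m <= pointwise_inf A h x.
Proof.
move=> [i Ai] hm; apply: lb_le_inf; first by exists (h i x), i.
by move=> _ [j Aj <-]; exact: hm.
Qed.

(** The index [k] merges the given ones: it is the smaller functional of two in a chain, and the sum
    or multiple of the parameters when they range over a cone or subspace. *)
Lemma pointwise_inf_sublinear : A !=set0 ->
  (forall i j x y, A i -> A j ->
     exists2 k, A k & h k (x + y) <= h i x + h j y) ->
  (forall i (t : R) x, A i -> 0 < t ->
     exists2 k, A k & h k (t%:C *: x) <= t * h i x) ->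
  sublinear (pointwise_inf A h).
Proof.
move=> A0 hD hZ; split=> [x y|t x t0].
  rewrite -lerBlDr; apply: le_pointwise_inf => // i Ai.
  rewrite lerBlDr -lerBlDl; apply: le_pointwise_inf => // j Aj.
  have [k Ak hk] := hD i j x y Ai Aj.
  by have := pointwise_inf_le (x + y) Ak; lra.
rewrite mulrC -ler_pdivrMr//; apply: le_pointwise_inf => // i Ai.
have [k Ak hk] := hZ i t x Ai t0.
by rewrite ler_pdivrMr// mulrC; exact: le_trans (pointwise_inf_le _ Ak) hk.
Qed.

End Infimum.

Definition tilt q (a : V) : V -> R :=
  pointwise_inf [set t : R | 0 <= t] (fun t x => q (x + t%:C *: a) - t * q a).

Section Tilt.
Variables (q : V -> R) (a : V).
Hypothesis qS : sublinear q.

Lemma tilt_lb x : exists m, forall t, 0 <= t ->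
  m <= q (x + t%:C *: a) - t * q a.
Proof.
exists (- q (- x)) => t t0; rewrite -sublinearZ//.
by have := qS.1 (x + t%:C *: a) (- x); rewrite addrAC subrr add0r; lra.
Qed.

Lemma tilt_le x t : 0 <= t -> tilt q a x <= q (x + t%:C *: a) - t * q a.
Proof. by move=> t0; apply: pointwise_inf_le => //; exact: tilt_lb. Qed.

Lemma tilt_le_self x : tilt q a x <= q x.
Proof. by have := tilt_le x (lexx 0); rewrite scale0r addr0; lra. Qed.

Lemma tilt_sublinear : sublinear (tilt q a).
Proof.
apply: pointwise_inf_sublinear; first exact: tilt_lb.
- by exists 0 => /=.
- move=> s t x y /= s0 t0; exists (s + t); first exact: addr_ge0.
  by have := qS.1 (x + s%:C *: a) (y + t%:C *: a);
    rewrite addrACA -scalerDl -rmorphD/=; lra.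
- move=> s t x /= s0 t0; exists (t * s); first by rewrite /= mulr_ge0// ltW.
  rewrite rmorphM/= -scalerA -scalerDr (sublinearZ _ qS (ltW t0)); lra.
Qed.

End Tilt.

Definition minorant p : Type :=
  {q : V -> R | sublinear q /\ forall x, q x <= p x}.

(** Zorn's lemma: a nonempty chain is bounded by its pointwise infimum, which is finite because
    every sublinear [q] below [p] satisfies [- p (- x) <= - q (- x) <= q x]. *)
Lemma minimal_minorant p : sublinear p -> exists q,
  [/\ sublinear q, forall x, q x <= p x &
      forall r, sublinear r -> (forall x, r x <= q x) -> r = q].
Proof.
move=> pS.
(* The order is reversed, so that maximal elements are minimal functionals. *)
pose le (q r : minorant p) : bool := `[< forall x, sval r x <= sval q x >].
have p0 : minorant p by exists p.
have [||A Atot|[q [qS qp]] qmin] := @ZL_preorder (minorant p) p0 le.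
- by move=> q; apply/asboolP.
- move=> r q s /asboolP qr /asboolP sq; apply/asboolP => x.
  exact: le_trans (sq x) (qr x).
- have [A0|A0] := pselect (A !=set0); last first.
    by exists p0 => s As; case: A0; exists s.
  pose h (q : minorant p) : V -> R := sval q.
  have h_lb x : exists m, forall q : minorant p, A q -> m <= h q x.
    exists (- p (- x)) => -[q [qS qp]] _ /=.
    by apply: le_trans (sublinearN _ qS); rewrite lerN2.
  have hS : sublinear (pointwise_inf A h).
    apply: pointwise_inf_sublinear => //.
    + move=> i j x y Ai Aj; case: (Atot _ _ Ai Aj) => /asboolP ij.
      * exists j => //; apply: le_trans ((svalP j).1.1 x y) _.
        by rewrite lerD2r.
      * exists i => //; apply: le_trans ((svalP i).1.1 x y) _.
        by rewrite lerD2l.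
    + by move=> i t x Ai t0; exists i => //; exact: (svalP i).1.2.
  have hp x : pointwise_inf A h x <= p x.
    have [i Ai] := A0; apply: le_trans (pointwise_inf_le h_lb _ Ai) _.
    exact: (svalP i).2.
  exists (exist _ (pointwise_inf A h) (conj hS hp)) => s As.
  by apply/asboolP => x; exact: pointwise_inf_le.
- exists q; split => // r rS rq.
  have rp x : r x <= p x by exact: le_trans (rq x) (qp x).
  have /asboolP/= := qmin (exist _ r (conj rS rp)) (asboolT rq).
  by move=> qr; apply/funext => x; apply/eqP; rewrite eq_le rq qr.
Qed.

(* A minimal sublinear functional coincides with all its tilts, which makes
   it superadditive, hence additive. *)
Lemma hahn_banach p z : sublinear p -> exists f : V -> R,
  [/\ forall x y, f (x + y) = f x + f y,
      forall (t : R) x, f (t%:C *: x) = t * f x,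
      forall x, f x <= p x & f z = p z].
Proof.
(* Minimising below the tilt of [p] at [z], rather than below [p], secures the value at [z]. *)
move=> pS; have tS := tilt_sublinear z pS.
have [q [qS qt qmin]] := minimal_minorant tS.
have qD x y : q (x + y) = q x + q y.
  apply/eqP; rewrite eq_le qS.1 /=.
  have qE : tilt q y = q.
    by apply: qmin; [exact: tilt_sublinear|exact: tilt_le_self].
  (* With [t = 1] the tilt yields [q x <= q (x + y) - q y]. *)
  by have := @tilt_le q y qS x 1 ler01; rewrite scale1r qE; lra.
have qN x : q (- x) = - q x.
  by have := qD x (- x); rewrite subrr sublinear0//; lra.
exists q; split => //.
- move=> t x; have [t0|/ltW t0] := leP 0 t; first exact: sublinearZ.
  rewrite -[t]opprK rmorphN/= scaleNr qN sublinearZ ?oppr_ge0//; lra.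
- by move=> x; apply: le_trans (qt x) _; exact: tilt_le_self.
- apply/eqP; rewrite eq_le (le_trans (qt z) (tilt_le_self _ pS _)) /=.
  (* The tilt at [- z] with [t = 1] gives [- q z <= - p z]. *)
  have := qt (- z); rewrite qN; have := @tilt_le p z pS (- z) 1 ler01.
  rewrite scale1r addNr sublinear0//; lra.
Qed.

End SublinearFunctionals.

(** * Real-valued norms, metric forms of density, closedness and continuity, and real parts of
    scalars *)

Section RealNorm.
Variables (R : realType) (V : normedZmodType R[i]).
Implicit Types x y z : V.

(** The norm has values in [R[i]]; its real part carries the same information inside the ordered
    field [R]. *)
Definition nrm x : R := complex.Re `|x|.

Lemma normE x : `|x| = (nrm x)%:C.
Proof. by rewrite /nrm RRe_real// ger0_real. Qed.

Lemma nrm_ge0 x : 0 <= nrm x.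
Proof. by rewrite -lecR -normE; exact: normr_ge0. Qed.

Lemma nrm0 : nrm 0 = 0.
Proof. by rewrite /nrm normr0. Qed.

Lemma nrmN x : nrm (- x) = nrm x.
Proof. by rewrite /nrm normrN. Qed.

Lemma nrmB x y : nrm (x - y) = nrm (y - x).
Proof. by rewrite /nrm distrC. Qed.

Lemma nrm_eq0 x : nrm x = 0 -> x = 0.
Proof. by move=> x0; apply/eqP; rewrite -normr_eq0 normE x0. Qed.

Lemma nrm_gt0 x : x != 0 -> 0 < nrm x.
Proof.
move=> x0; rewrite lt_neqAle nrm_ge0 andbT eq_sym.
by apply: contra_neq x0; exact: nrm_eq0.
Qed.

Lemma nrmD x y : nrm (x + y) <= nrm x + nrm y.
Proof. by rewrite -lecR rmorphD/= -!normE ler_normD. Qed.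

Lemma nrmBD z x y : nrm (x - y) <= nrm (x - z) + nrm (z - y).
Proof. by rewrite -(subrKA z); exact: nrmD. Qed.

End RealNorm.

Section NormedModule.
Variables (R : realType) (V : normedModType R[i]).
Implicit Types (x y z : V) (A : set V).

Lemma nrmZ (a : R[i]) x : nrm (a *: x) = nrm a * nrm x.
Proof.
by rewrite /nrm normrZ [`|a|]normE [`|x|]normE -rmorphM.
Qed.

Lemma nrmZr (t : R) x : nrm (t%:C *: x) = `|t| * nrm x.
Proof. by rewrite nrmZ {1}/nrm normc_def /= expr0n addr0 sqrtr_sqr. Qed.

Lemma nrmZi x : nrm ('i%C *: x) = nrm x.
Proof.
by rewrite nrmZ {1}/nrm normc_def /= expr0n add0r expr1n sqrtr1 mul1r.
Qed.

Lemma nbhs_nrmP x (P : set V) :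
  nbhs x P <-> exists2 e : R, 0 < e & forall y, nrm (x - y) < e -> P y.
Proof.
split=> [/nbhs_ballP[e e0 xe]|[e e0 xe]].
  have eE : e = (complex.Re e)%:C by rewrite RRe_real// gtr0_real.
  exists (complex.Re e); first by rewrite -ltcR -eE.
  by move=> y xy; apply: xe; rewrite -ball_normE /= normE eE ltcR.
apply/nbhs_ballP; exists e%:C; first by rewrite /= ltcR.
by move=> y; rewrite -ball_normE /= normE ltcR; exact: xe.
Qed.

Lemma denseP A : dense A <->
  forall x (e : R), 0 < e -> exists2 a, A a & nrm (x - a) < e.
Proof.
split=> [dA x e e0|dA U [x Ux] oU].
  have : nbhs x [set y | nrm (x - y) < e] by apply/nbhs_nrmP; exists e.
  rewrite nbhsE => -[U [oU Ux] UA].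
  have [|a [Ua Aa]] := dA U _ oU; first by exists x.
  by exists a => //; exact: UA.
have /nbhs_nrmP[e e0 xe] : nbhs x U by exact: open_nbhs_nbhs.
by have [a Aa xa] := dA x e e0; exists a; split => //; exact: xe.
Qed.

Lemma closedP A : closed A <-> forall x,
  (forall e : R, 0 < e -> exists2 a, A a & nrm (x - a) < e) -> A x.
Proof.
split=> [cA x xA|cA x xA].
  apply: cA => B /nbhs_nrmP[e e0 xe].
  by have [a Aa xa] := xA e e0; exists a; split => //; exact: xe.
apply: cA => e e0.
have [|a [Aa xa]] := xA [set y | nrm (x - y) < e]; last by exists a.
by apply/nbhs_nrmP; exists e.
Qed.

End NormedModule.

Section ScalarContinuity.
Variables (R : realType) (V : normedModType R[i]) (g : V -> R[i]^o).

Lemma cvg_nrmP x (F : set_system V) : Filter F ->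
  g y @[y --> F] --> g x <->
  forall e : R, 0 < e -> \forall y \near F, nrm (g x - g y) < e.
Proof.
move=> FF; split=> [/cvgrPdist_lt gx e e0|gx].
  have := gx e%:C; rewrite ltcR => /(_ e0).
  by apply: filterS => y; rewrite normE ltcR.
apply/cvgrPdist_lt => e e0.
have eE : e = (complex.Re e)%:C by rewrite RRe_real// gtr0_real.
have := gx (complex.Re e); rewrite -ltcR -eE => /(_ e0).
by apply: filterS => y; rewrite -ltcR -normE -eE.
Qed.

Lemma lipschitz_within_continuous (D : set V) (B : R) :
  (forall x y, D x -> D y -> nrm (g x - g y) <= B * nrm (x - y)) ->
  {within D, continuous g}.
Proof.
move=> gB; apply/subspace_continuousP => x Dx; apply/cvg_nrmP => e e0.
(* The sign of [B] is arbitrary, so a positive majorant is used as divisor. *)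
have B0 : 0 < `|B| + 1 by rewrite ltr_wpDl.
apply/nbhs_nrmP; exists (e / (`|B| + 1)); first exact: divr_gt0.
move=> y xy Dy; apply: le_lt_trans (gB x y Dx Dy) _.
move: xy; rewrite ltr_pdivlMr// => xy.
apply: le_lt_trans xy; rewrite mulrC ler_wpM2l ?nrm_ge0//.
by have := ler_norm B; lra.
Qed.

End ScalarContinuity.

Lemma lipschitz_continuous (R : realType) (V : normedModType R[i])
    (g : V -> R[i]^o) (B : R) :
  (forall x y, nrm (g x - g y) <= B * nrm (x - y)) -> continuous g.
Proof.
move=> gB; apply/continuous_subspace_setT.
by apply: (@lipschitz_within_continuous _ _ _ _ B) => x y _ _; exact: gB.
Qed.

Lemma nrm_le_ReIm (R : realType) (c : R[i]) :
  nrm c <= `|complex.Re c| + `|complex.Im c|.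
Proof.
rewrite {1}[c]complexE; apply: le_trans (nrmD _ _) _.
rewrite {1}/nrm normc_def /= expr0n addr0 sqrtr_sqr lerD2l.
rewrite /nrm normrM !normc_def /= !expr0n /= add0r addr0 expr1n sqrtr1
  sqrtr_sqr.
lra.
Qed.

Section RealPart.
Variable R : realType.
Implicit Types c d : R[i].

Lemma cReD c d : complex.Re (c + d) = complex.Re c + complex.Re d.
Proof. by case: c d => [a b] []. Qed.

Lemma cReN c : complex.Re (- c) = - complex.Re c.
Proof. by case: c. Qed.

Lemma cReZ (t : R) c : complex.Re (t%:C * c) = t * complex.Re c.
Proof. by case: c => a b /=; rewrite mul0r subr0. Qed.

Lemma cReJ c : complex.Re (conjC c) = complex.Re c.
Proof. by case: c. Qed.

Lemma normr_Re_le c : `|complex.Re c| <= nrm c.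
Proof. by rewrite -lecR -normE normc_ge_Re. Qed.

Lemma nrmM c d : nrm (c * d) = nrm c * nrm d.
Proof. exact: (@nrmZ _ R[i]^o). Qed.

Lemma nrm_real (t : R) : nrm (t%:C : R[i]) = `|t|.
Proof. by rewrite /nrm normc_def /= expr0n addr0 sqrtr_sqr. Qed.

Lemma conjC_real_complex (t : R) : conjC (t%:C : R[i]) = t%:C.
Proof. exact: conjc_real. Qed.

Lemma nrmJ c : nrm (conjC c) = nrm c.
Proof. by rewrite /nrm norm_conjC. Qed.

End RealPart.

(** * Complex Hahn-Banach extension and separation *)

Section ComplexHahnBanach.
Variables (R : realType) (V : normedModType R[i]).
Implicit Types (x y z u v : V).

(** For real-linear [f], this is the unique complex-linear functional with real part [f]. *)
Definition complexify (f : V -> R) x : R[i] := f x +i* - f ('i%C *: x).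

Lemma complexify_linear (f : V -> R) :
  (forall x y, f (x + y) = f x + f y) ->
  (forall (t : R) x, f (t%:C *: x) = t * f x) ->
  linear_for *%R (complexify f).
Proof.
move=> fD fZ c x y; rewrite {1}/complexify.
have fN z : f (- z) = - f z.
  by have := fZ (-1) z; rewrite rmorphN1 scaleN1r mulN1r.
have fc (a b : R) z : f ((a +i* b) *: z) = a * f z + b * f ('i%C *: z).
  rewrite [a +i* b]complexE /= scalerDl fD fZ ['i%C * _]mulrC.
  by rewrite -scalerA fZ.
case: c => a b; rewrite scalerDr !fD scalerA.
have -> : 'i%C * (a +i* b) = (- b) +i* a by simpc.
by rewrite (fc a b) (fc (- b) a) /complexify; simpc; congr (_ +i* _); lra.
Qed.

Lemma complexify_bound (f : V -> R) (B : R) x :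
  (forall y, `|f y| <= B * nrm y) -> nrm (complexify f x) <= 2 * B * nrm x.
Proof.
move=> fB; apply: le_trans (nrm_le_ReIm _) _; rewrite /= normrN.
by have := fB x; have := fB ('i%C *: x); rewrite nrmZi; lra.
Qed.

(* The extension [F] is built from the sublinear functional
   x |-> inf_{u in D} (B |x - u| + Re (psi u)). *)
Lemma hahn_banach_extension (D : set V) (psi : V -> R[i]) (B : R) z :
  D 0 -> (forall (a : R[i]) x y, D x -> D y -> D (a *: x + y)) ->
  (forall (a : R[i]) x y, D x -> D y -> psi (a *: x + y) = a * psi x + psi y) ->
  0 <= B -> (forall x, D x -> nrm (psi x) <= B * nrm x) ->
  exists F : V -> R[i],
    [/\ linear_for *%R F, continuous (F : V -> R[i]^o),
        forall x, D x -> F x = psi x &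
        forall m,
          (forall u, D u -> m <= B * nrm (z - u) + complex.Re (psi u)) ->
          m <= complex.Re (F z)].
Proof.
move=> D0 DP psiP B0 psiB.
have DD x y : D x -> D y -> D (x + y).
  by move=> Dx Dy; have := DP 1 x y Dx Dy; rewrite scale1r.
have DZ a x : D x -> D (a *: x).
  by move=> Dx; have := DP a x 0 Dx D0; rewrite addr0.
have psiD x y : D x -> D y -> psi (x + y) = psi x + psi y.
  by move=> Dx Dy; have := psiP 1 x y Dx Dy; rewrite scale1r mul1r.
have psi0 : psi 0 = 0.
  by have := psiP (-1) 0 0 D0 D0; rewrite scaler0 addr0 mulN1r addNr.
have psiZ a x : D x -> psi (a *: x) = a * psi x.
  by move=> Dx; have := psiP a x 0 Dx D0; rewrite !addr0 psi0 addr0.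
pose h u x := B * nrm (x - u) + complex.Re (psi u).
have h_lb x : exists m, forall u, D u -> m <= h u x.
  (* From [- Re (psi u) <= B |u| <= B |x - u| + B |x|]. *)
  exists (- (B * nrm x)) => u Du; rewrite /h.
  have := normr_Re_le (psi u); rewrite ler_norml => /andP[+ _].
  have := psiB u Du; have := nrmBD x u 0; rewrite !subr0 => /(ler_wpM2l B0).
  rewrite mulrDr (nrmB u); lra.
have hS : sublinear (pointwise_inf D h).
  apply: pointwise_inf_sublinear => //.
  - by exists 0.
  - move=> u v x y Du Dv; exists (u + v); first exact: DD.
    rewrite /h psiD// cReD opprD addrACA.
    by have := ler_wpM2l B0 (nrmD (x - u) (y - v)); lra.
  - move=> u t x Du t0; exists (t%:C *: u); first exact: DZ.
    by rewrite /h psiZ// -scalerBr nrmZr gtr0_norm// cReZ; lra.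
have [f [fD fZ fp fz]] := hahn_banach z hS.
have fN x : f (- x) = - f x.
  by have := fZ (-1) x; rewrite rmorphN1 scaleN1r mulN1r.
have fB x : `|f x| <= B * nrm x.
  have fle y : f y <= B * nrm y.
    apply: le_trans (fp y) _; have := pointwise_inf_le h_lb y D0.
    by rewrite /h psi0 subr0 addr0.
  by rewrite ler_norml fle andbT; have := fle (- x); rewrite fN nrmN; lra.
(* Taking [u = x] in the infimum gives [f <= Re psi] on [D]; the same at [- x] gives equality. *)
have fD_psi x : D x -> f x = complex.Re (psi x).
  have fle y : D y -> f y <= complex.Re (psi y).
    move=> Dy; apply: le_trans (fp y) _; have := pointwise_inf_le h_lb y Dy.
    by rewrite /h subrr nrm0 mulr0 add0r.
  move=> Dx; apply/eqP; rewrite eq_le fle//=.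
  have := fle _ (DZ (-1) x Dx); rewrite scaleN1r fN -scaleN1r psiZ//.
  by rewrite mulN1r cReN; lra.
exists (complexify f); have Flin := complexify_linear fD fZ; split => //.
- apply: (@lipschitz_continuous _ _ _ (2 * B)) => x y.
  have -> : complexify f x - complexify f y = complexify f (x - y).
    by rewrite [x - y]addrC -(scaleN1r y) Flin mulN1r addrC.
  exact: complexify_bound.
- move=> x Dx; rewrite /complexify !fD_psi ?psiZ//; last exact: DZ.
  by case: (psi x) => a b; simpc.
(* [f] attains the sublinear functional at [z], so lower bounds of that infimum pass to [Re (F z)].
   With [psi = 0] this separates [z] from [D]. *)
- by move=> m hm; rewrite /= fz; apply: le_pointwise_inf => //; exists 0.
Qed.

End ComplexHahnBanach.

(** * Hilbert spaces: projection onto closed convex sets and Riesz representation *)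

Lemma cauchy_sequence_cvg (R : realType) (H : completeNormedModType R[i])
    (u : nat -> H) :
  (forall e : R, 0 < e -> exists N, forall n m, (N <= n)%N -> (N <= m)%N ->
     nrm (u n - u m) < e) ->
  exists l, forall e : R, 0 < e ->
    exists N, forall n, (N <= n)%N -> nrm (l - u n) < e.
Proof.
move=> uC.
have /cauchy_cvg/cvg_ex[l ul] : cauchy (u @ \oo).
  apply: cauchy_exP => e e0.
  have eE : e = (complex.Re e)%:C by rewrite RRe_real// gtr0_real.
  have [|N uN] := uC (complex.Re e); first by rewrite -ltcR -eE.
  exists (u N), N => // n /= Nn.
  by rewrite -ball_normE /= normE eE ltcR uN.
exists l => e e0.
have : nbhs l [set x | nrm (l - x) < e] by apply/nbhs_nrmP; exists e.
by move=> /ul[N _ uN]; exists N => n Nn; exact: uN.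
Qed.

Section InnerProduct.
Variables (R : realType) (H : completeNormedModType R[i]).
Variable ip : {dot H for conjC}.
Hypothesis ipH : inner_product_of_norm ip.
Implicit Types (x y z f : H) (K : set H).

Lemma ipC x y : ip x y = conjC (ip y x).
Proof. by rewrite hermC /= expr0 mul1r. Qed.

Lemma nrm_sqr x : nrm x ^+ 2 = complex.Re (ip x x).
Proof. by rewrite ipH normE -rmorphXn. Qed.

Lemma nrm_sqrD x y :
  nrm (x + y) ^+ 2 = nrm x ^+ 2 + nrm y ^+ 2 + 2 * complex.Re (ip x y).
Proof.
rewrite !nrm_sqr linearDl !linearDr !cReD /= (ipC y x) cReJ; lra.
Qed.

Lemma nrm_sqrB x y :
  nrm (x - y) ^+ 2 = nrm x ^+ 2 + nrm y ^+ 2 - 2 * complex.Re (ip x y).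
Proof. by rewrite nrm_sqrD nrmN linearNr cReN; lra. Qed.

Lemma ip_Re_le x y : complex.Re (ip x y) <= nrm x * nrm y.
Proof.
have [->|x0] := eqVneq x 0; first by rewrite linear0l nrm0 mul0r.
have [->|y0] := eqVneq y 0; first by rewrite linear0r nrm0 mulr0.
have nx : 0 < nrm x by exact: nrm_gt0.
have ny : 0 < nrm y by exact: nrm_gt0.
(* Expanding this square gives twice [|x| |y| (|x| |y| - Re <x, y>)], and [|x| |y|] is positive. *)
have := sqr_ge0 (nrm ((nrm y)%:C *: x - (nrm x)%:C *: y)).
rewrite nrm_sqrB !nrmZr !ger0_norm ?nrm_ge0// linearZl_LR linearZr_LR/=.
rewrite !conjC_real_complex !cReZ.
set r := complex.Re _.
have := mulr_gt0 nx ny; nra.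
Qed.

(** Real and imaginary parts are bounded separately, the latter through ['i *: x]; hence the factor
    2. *)
Lemma ip_le x y : nrm (ip x y) <= 2 * (nrm x * nrm y).
Proof.
have Re_le x' y' : `|complex.Re (ip x' y')| <= nrm x' * nrm y'.
  rewrite ler_norml ip_Re_le andbT.
  by have := ip_Re_le (- x') y'; rewrite linearNl cReN nrmN; lra.
apply: le_trans (nrm_le_ReIm _) _.
have := Re_le x y; have := Re_le ('i%C *: x) y.
rewrite linearZl_LR nrmZi.
have -> : complex.Re ('i%C * ip x y) = - complex.Im (ip x y).
  by case: (ip x y) => a b /=; lra.
rewrite normrN; lra.
Qed.

(** A minimising sequence for the distance is Cauchy by the parallelogram law; moving slightly from
    its limit [y] towards [z] gives the variational inequality. *)
Lemma hilbert_projection K f : closed K -> K !=set0 ->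
  (forall (t : R) x y, 0 <= t <= 1 -> K x -> K y -> K (x + t%:C *: (y - x))) ->
  exists2 y, K y & forall z, K z -> complex.Re (ip (f - y) (z - y)) <= 0.
Proof.
move=> cK [k0 Kk0] convK.
pose d := inf [set nrm (f - z) | z in K].
have d0 : 0 <= d.
  apply: lb_le_inf; first by exists (nrm (f - k0)), k0.
  by move=> _ [z _ <-]; exact: nrm_ge0.
have d_le z : K z -> d <= nrm (f - z).
  move=> Kz; apply: ge_inf; last by exists z.
  by exists 0 => _ [w _ <-]; exact: nrm_ge0.
have /choice[u uP] n : exists z, K z /\ nrm (f - z) < d + n.+1%:R^-1.
  have [||_ [z Kz <-] zd] :=
    @inf_adherent R [set nrm (f - z) | z in K] n.+1%:R^-1.
  - by rewrite invr_gt0 ltr0n.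
  - split; first by exists (nrm (f - k0)), k0.
    by exists 0 => _ [w _ <-]; exact: nrm_ge0.
  - by exists z.
(* The midpoint lies in [K], so the parallelogram law bounds the square by
   [4 (d + e)^2 - 4 d^2 = 8 d e + 4 e^2], and [e^2 <= e]. *)
have u_close n m (e : R) : n.+1%:R^-1 <= e -> m.+1%:R^-1 <= e -> e <= 1 ->
    nrm (u n - u m) ^+ 2 <= 4 * (2 * d + 1) * e.
  move=> ne me e1.
  have [Kn dn] := uP n; have [Km dm] := uP m.
  have mid : d <= nrm (f - (u n + 2^-1%:C *: (u m - u n))).
    by apply/d_le/convK => //; apply/andP; split; lra.
  have midE (a b : H) : a - 2^-1%:C *: (a - b) = 2^-1%:C *: (a + b).
    have h2 : (2^-1%:C + 2^-1%:C : R[i]) = 1.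
      by rewrite -rmorphD/=; congr (_%:C); lra.
    rewrite -{1}[a]scale1r -h2 scalerDl scalerBr opprB addrACA subrr addr0.
    by rewrite scalerDr.
  have uB p q : u p - u q = (f - u q) - (f - u p).
    by rewrite opprB [RHS]addrC subrKA.
  move: mid; rewrite opprD addrA (uB m n) midE nrmZr.
  rewrite ger0_norm ?invr_ge0// => mid.
  have e0 : 0 <= e by apply: le_trans ne; rewrite invr_ge0.
  rewrite uB.
  have := nrm_sqrD (f - u n) (f - u m).
  have := nrm_sqrB (f - u m) (f - u n).
  rewrite (ipC (f - u m)) cReJ.
  have an : nrm (f - u n) <= d + e.
    by apply: ltW (lt_le_trans dn _); rewrite lerD2l.
  have am : nrm (f - u m) <= d + e.
    by apply: ltW (lt_le_trans dm _); rewrite lerD2l.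
  have := nrm_ge0 (f - u n); have := nrm_ge0 (f - u m).
  move: mid an am; set a := nrm (f - u n); set b := nrm (f - u m).
  set s := nrm _; set r := nrm _; set c := complex.Re _.
  move=> mid an am a0 b0 -> sE.
  have : (2 * d) ^+ 2 <= s ^+ 2 by rewrite ler_sqr ?nnegrE//; nra.
  have : a ^+ 2 <= (d + e) ^+ 2 by rewrite ler_sqr ?nnegrE//; lra.
  have : b ^+ 2 <= (d + e) ^+ 2 by rewrite ler_sqr ?nnegrE//; lra.
  have : e ^+ 2 <= e by rewrite expr2 ler_piMl.
  nra.
have inv_small (e : R) : 0 < e -> exists N, forall n, (N <= n)%N ->
    n.+1%:R^-1 <= e.
  move=> e0; exists (Num.truncn e^-1) => n Nn.
  rewrite invf_ple ?posrE ?ltr0n//.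
  apply: le_trans (ltW (truncnS_gt _)) _.
  by rewrite ler_nat ltnS.
have [|y uy] := cauchy_sequence_cvg (u := u).
  move=> e e0; have D0 : 0 < 8 * (2 * d + 1) by lra.
  (* The constant makes the bound from [u_close] at most [e^2 / 2]. *)
  have [|N hN] := inv_small (Num.min 1 (e ^+ 2 / (8 * (2 * d + 1)))).
    by rewrite lt_min ltr01 divr_gt0// exprn_gt0.
  exists N => n m /hN; rewrite le_min => /andP[n1 ne] /hN.
  rewrite le_min => /andP[m1 me].
  pose e' := Num.min 1 (e ^+ 2 / (8 * (2 * d + 1))).
  have := @u_close n m e'; rewrite !le_min n1 ne m1 me ge_min lexx /=.
  move=> /(_ isT isT isT) h.
  have : e' <= e ^+ 2 / (8 * (2 * d + 1)) by rewrite ge_min lexx orbT.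
  rewrite ler_pdivlMr// => e'e.
  have e20 : 0 < e ^+ 2 by rewrite exprn_gt0.
  rewrite -(ltr_pXn2r (n := 2))// ?nnegrE ?nrm_ge0 ?(ltW e0)//.
  by apply: le_lt_trans h _; lra.
have Ky : K y.
  move/closedP: cK; apply => e /uy[N uN].
  by exists (u N); [exact: (uP N).1|exact: uN].
have y_min z : K z -> nrm (f - y) <= nrm (f - z).
  move=> Kz; apply: le_trans (d_le z Kz); apply/ler_addgt0Pr => e e0.
  have [|N1 h1] := uy (e / 2); first by rewrite divr_gt0.
  have [|N2 h2] := inv_small (e / 2); first by rewrite divr_gt0.
  have := h1 _ (leq_maxl N1 N2); have := h2 _ (leq_maxr N1 N2).
  have := (uP (maxn N1 N2)).2; have := nrmBD (u (maxn N1 N2)) f y.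
  rewrite (nrmB y); move: (_.+1%:R^-1) => w; lra.
exists y => // z Kz; rewrite leNgt; apply/negP => r0.
set r := complex.Re _ in r0.
have n0 := sqr_ge0 (nrm (z - y)).
(* Expand [|f - y|^2 <= |f - y - t (z - y)|^2] and divide by [t]. *)
have key (t : R) : 0 < t -> t <= 1 -> 2 * r <= t * nrm (z - y) ^+ 2.
  move=> t0 t1.
  have /y_min : K (y + t%:C *: (z - y)) by apply: convK; rewrite // t1 ltW.
  rewrite -ler_sqr ?nnegrE ?nrm_ge0// opprD addrA (nrm_sqrB (f - y)).
  rewrite linearZr_LR /=.
  rewrite conjC_real_complex cReZ -/r nrmZr gtr0_norm// exprMn.
  by move=> h; rewrite -(ler_pM2l t0); nra.
(* This [t] satisfies [t (|z - y|^2 + 1) <= r], contradicting [2 r <= t |z - y|^2]. *)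
have := key (Num.min 1 (r / (nrm (z - y) ^+ 2 + 1))).
have D0 : 0 < nrm (z - y) ^+ 2 + 1 by lra.
rewrite lt_min ltr01 divr_gt0// ge_min lexx => /(_ isT isT).
set t := Num.min _ _ => h.
have : t <= r / (nrm (z - y) ^+ 2 + 1) by rewrite ge_min lexx orbT.
rewrite ler_pdivlMr//.
have : 0 < t by rewrite lt_min ltr01 divr_gt0.
lra.
Qed.

(* Riesz: the projection of 0 onto the affine hyperplane [F = 1] is orthogonal
   to the kernel of [F]. *)
Lemma riesz_representation (F : H -> R[i]) :
  linear_for *%R F -> continuous (F : H -> R[i]^o) ->
  exists k, forall x, F x = ip x k.
Proof.
move=> Flin Fc.
have FD x y : F (x + y) = F x + F y.
  by have := Flin 1 x y; rewrite scale1r mul1r.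
have F0 : F 0 = 0.
  by have := Flin (-1) 0 0; rewrite scaler0 addr0 mulN1r addNr.
have FZ a x : F (a *: x) = a * F x by have := Flin a x 0; rewrite F0 !addr0.
have FB x y : F (x - y) = F x - F y.
  by rewrite FD -(scaleN1r y) FZ mulN1r.
have [F_eq0|] := pselect (forall x, F x = 0).
  by exists 0 => x; rewrite linear0r F_eq0.
move=> /existsNP[x1 /eqP Fx1].
pose K := [set x | F x = 1].
have cK : closed K.
  apply/closedP => x xK; apply/eqP; rewrite -subr_eq0; apply/negP => /negP Fx.
  have nF : 0 < nrm (F x - 1) by exact: nrm_gt0.
  have /nbhs_nrmP[e e0 xe] :
    nbhs x [set y | nrm (F x - F y) < nrm (F x - 1)].
    exact: (cvg_nrmP F x _).1 (Fc x) _ nF.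
  have [z Kz /xe] := xK e e0; by rewrite /= Kz ltxx.
have [|t x y _ Kx Ky|y Ky yP] := @hilbert_projection K 0 cK.
- by exists ((F x1)^-1 *: x1); rewrite /K/= FZ mulVf.
- by rewrite /K/= FD FZ FB Kx Ky subrr mulr0 addr0.
(* Adding a kernel vector to [y] stays in [K], so the variational inequality applies to [w], [- w]
   and ['i *: w]. *)
have orth w : F w = 0 -> ip y w = 0.
  move=> Fw.
  have Re_ge x : F x = 0 -> 0 <= complex.Re (ip y x).
    move=> Fx; have := yP (y + x); rewrite /K/= FD Fx addr0 => /(_ Ky).
    by rewrite sub0r addrAC subrr add0r linearNl cReN; lra.
  have Re0 x : F x = 0 -> complex.Re (ip y x) = 0.
    move=> Fx; apply/eqP; rewrite eq_le Re_ge// andbT.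
    have := Re_ge (- x); rewrite -scaleN1r FZ Fx mulr0 => /(_ erefl).
    by rewrite scaleN1r linearNr cReN; lra.
  apply/eqP; rewrite eq_complex Re0//= eqxx /=.
  have := Re0 ('i%C *: w); rewrite FZ Fw mulr0 => /(_ erefl).
  rewrite linearZr_LR /=; case: (ip y w) => a b /=.
  by move=> h; apply/eqP; lra.
have y0 : ip y y != 0.
  rewrite ipH expf_neq0// normr_eq0; apply: contraPneq Ky => ->.
  by rewrite /K/= F0 => /eqP; rewrite eq_sym oner_eq0.
(* Since [F y = 1], [x - F x *: y] lies in the kernel; orthogonality to [y] gives
   [ip x y = F x * ip y y], which fixes the scaling. *)
exists ((ip y y)^-1 *: y) => x; rewrite linearZr_LR /= conj_Creal; last first.
  by rewrite realV ipH realX// normr_real.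
have : ip y (x - F x *: y) = 0.
  by apply: orth; rewrite FB FZ Ky mulr1 subrr.
rewrite ipC => /(congr1 conjC); rewrite conjCK conjC0 linearBl linearZl_LR /=.
by move=> /eqP; rewrite subr_eq0 => /eqP ->; rewrite mulrCA mulVf ?mulr1.
Qed.

End InnerProduct.

(** * Partially defined linear operators and their adjoint domains *)

Section OperatorTheory.
Variables (R : realType) (X Y : normedModType R[i]) (T : operator X Y).

Lemma domB x y : dom T x -> dom T y -> dom T (x - y).
Proof.
by move=> Dx Dy; have := domP (-1) Dy Dx; rewrite scaleN1r addrC.
Qed.

Lemma op0 : T 0 = 0.
Proof.
have := opfunP (-1) (dom0 T) (dom0 T).
by rewrite scaler0 addr0 scaleN1r addNr.
Qed.

Lemma domZ a x : dom T x -> dom T (a *: x).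
Proof. by move=> Dx; have := domP a Dx (dom0 T); rewrite addr0. Qed.

Lemma opZ a x : dom T x -> T (a *: x) = a *: T x.
Proof.
by move=> Dx; have := opfunP a Dx (dom0 T); rewrite op0 !addr0.
Qed.

Lemma opB x y : dom T x -> dom T y -> T (x - y) = T x - T y.
Proof.
by move=> Dx Dy; have := opfunP (-1) Dy Dx; rewrite !scaleN1r addrC => ->;
  rewrite addrC.
Qed.

Lemma ranB x y : ran T x -> ran T y -> ran T (x - y).
Proof.
move=> [u Du <-] [v Dv <-]; exists (u - v); first exact: domB.
exact: opB.
Qed.

Lemma bounded_adjoint_dom (ip : {dot Y for conjC}) (h : Y) (B : R) :
  (forall x, dom T x -> nrm (ip h (T x)) <= B * nrm x) -> adjoint_dom T ip h.
Proof.
move=> hB; apply: (@lipschitz_within_continuous _ _ _ _ B) => x y Dx Dy.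
by rewrite -linearBr -opB// hB//; exact: domB.
Qed.

End OperatorTheory.

(** Dual pairs represent antilinear functionals, whereas Hahn-Banach delivers linear ones. *)
Lemma antidual_conj (R : realType) (X : normedModType R[i]) (F : X -> R[i]) :
  linear_for *%R F -> continuous (F : X -> R[i]^o) ->
  antidual (fun x => conjC (F x)).
Proof.
move=> Flin Fc; split=> [a x y|x].
  by rewrite Flin rmorphD rmorphM.
apply: (@cvg_nrmP _ _ (fun x => conjC (F x)) x (nbhs x) _).2 => e e0.
apply: filterS ((cvg_nrmP F x _).1 (Fc x) e e0) => y.
by rewrite -rmorphB nrmJ.
Qed.

(** * Quasi Gelfand triples: membership in the two ranges and the splitting of [f] *)

Section QuasiGelfand.
Variables (R : realType) (Xp X0 Xm : completeNormedModType R[i]).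
Variables (pairing : {sesquilinear Xm -> Xp -> R[i]}).
Variables (ip : {dot X0 for conjC}).
Variables (iotap : operator Xp X0) (iotam : operator Xm X0).

(** By continuity at 0 the form is below 1 on a ball of radius [e]; rescaling both arguments to norm
    [t = e / 2] gives the constant [t ^- 2]. *)
Lemma pairing_bound : complete_dual_pair pairing ->
  exists2 M : R, 0 <= M &
    forall u x, nrm (pairing u x) <= M * (nrm u * nrm x).
Proof.
move=> [pc _ _].
have /nbhs_nrmP[e e0 he] : nbhs (0 : Xm * Xp)
    [set p | nrm (pairing p.1 p.2) < 1].
  apply: filterS ((cvg_nrmP (fun p : Xm * Xp => pairing p.1 p.2) 0 _).1 (pc 0)
    1 ltr01) => p /=.
  by rewrite linear0l sub0r nrmN.
pose t := e / 2; have t0 : 0 < t by rewrite divr_gt0.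
exists (t ^- 2); first by rewrite invr_ge0 sqr_ge0.
move=> u x.
have [->|u0] := eqVneq u 0; first by rewrite linear0l !nrm0 mul0r mulr0.
have [->|x0] := eqVneq x 0; first by rewrite linear0r !nrm0 !mulr0.
have nu := nrm_gt0 u0; have nx := nrm_gt0 x0.
have small (V : normedModType R[i]) (v : V) : 0 < nrm v ->
    nrm ((t / nrm v)%:C *: v) = t.
  by move=> v0; rewrite nrmZr gtr0_norm ?divr_gt0// divfK ?gt_eqF.
have := he ((t / nrm u)%:C *: u, (t / nrm x)%:C *: x).
have -> : nrm ((0 : Xm * Xp) - ((t / nrm u)%:C *: u, (t / nrm x)%:C *: x)) = t.
  rewrite sub0r nrmN /nrm prod_normE /= !normE !small// maxxx //.
move=> /(_ _)/=; rewrite linearZl_LR linearZr_LR /= conjC_real_complex.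
rewrite nrmM nrmM !nrm_real !gtr0_norm ?divr_gt0// => /(_ _) h.
rewrite ler_pdivlMl ?exprn_gt0//.
have -> : t ^+ 2 * nrm (pairing u x) =
    nrm u * nrm x * (t / nrm u * (t / nrm x * nrm (pairing u x))).
  by field; rewrite !gt_eqF.
by rewrite -[leRHS]mulr1 ler_wpM2l ?mulr_ge0 ?nrm_ge0// ltW// h// /t; lra.
Qed.

Hypothesis Q : quasi_Gelfand_triple pairing ip iotap iotam.

Let dual_pair : complete_dual_pair pairing.
Proof. by case: Q => -[]. Qed.

Let ipH : inner_product_of_norm ip.
Proof. by case: Q => -[]. Qed.

Let embp : embedding iotap.
Proof. by case: Q => -[]. Qed.

Let embm : embedding iotam.
Proof. by case: Q => -[]. Qed.

Let pairingE f g : dom iotap f -> dom iotam g ->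
  pairing g f = ip (iotam g) (iotap f).
Proof. by case: Q => -[] _ _ _ _ + _; exact. Qed.

Let adjE h : adjoint_dom iotap ip h -> ran iotam h.
Proof. by case: Q => _ ->. Qed.

(** Boundedness of the pairing extends the equality from the dense subspace [dom iotap]. *)
Lemma pairing_eq_on_dom u v : (forall f, dom iotap f ->
  pairing u f = pairing v f) -> forall f, pairing u f = pairing v f.
Proof.
move=> uv f; have [M M0 hM] := pairing_bound dual_pair.
apply/eqP; rewrite -subr_eq0; apply/eqP/nrm_eq0/eqP.
rewrite eq_le nrm_ge0 andbT; apply/ler_addgt0Pr => e e0; rewrite add0r.
have D0 : 0 < M * nrm (u - v) + 1 by rewrite ltr_wpDl// mulr_ge0// nrm_ge0.
have /denseP/(_ f _ (divr_gt0 e0 D0))[g Dg] := densely_defined embp.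
rewrite ltr_pdivlMr// => fg.
have -> : pairing u f - pairing v f = pairing (u - v) (f - g).
  by rewrite linearBl !linearBr (uv g Dg) opprB addrA subrK.
apply: le_trans (hM _ _) _; have := nrm_ge0 (f - g); lra.
Qed.

(* A functional separating [(x, y)] from the graph of [iotap] has the form
   (f, h) |-> <u, f> + <h, k>, up to conjugation; vanishing on the graph forces
   [k] into [dom iotap^* = ran iotam], so it vanishes at [(x, y)] too. *)
Lemma bounded_ran_iotap y (e : R) : 0 <= e ->
  (forall u, dom iotam u -> nrm (ip (iotam u) y) <= e * nrm u) ->
  ran iotap y.
Proof.
move=> e0 yB.
(* The functional [u |-> <iotam u, y>] extends to all of [Xm] and is represented by [x]. *)
have [|F [Flin Fc FE _]] := @hahn_banach_extension _ _ (dom iotam)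
  (fun u => ip (iotam u) y) e 0 (dom0 iotam) (@domP _ _ _ iotam) _ e0 yB.
  by move=> a u v Du Dv /=; rewrite opfunP// linearDl linearZl_LR.
have [x _ xE] : exists2 x, setT x &
    (fun u => conjC (pairing u x)) = (fun u => conjC (F u)).
  case: (form_antidual_right dual_pair) => -[_ _ surj] _.
  exact: surj (antidual_conj Flin Fc).
have pxE u : dom iotam u -> pairing u x = ip (iotam u) y.
  move=> Du; rewrite -FE//; apply: (can_inj conjCK).
  by have := congr1 (fun f => f u) xE.
apply: contrapT => nran.
(* Outside the closed graph, [(x, y)] has positive distance from it. *)
have [d d0 dP] : exists2 d : R, 0 < d &
    forall p, graph iotap p -> d <= nrm ((x, y) - p).
  apply: contrapT => nd; apply: nran.
  suff [Dx /esym yE] : graph iotap (x, y) by exists x.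
  apply: (closedP _).1 (closed_graph embp) _ _ => d d0.
  apply: contrapT => nh; apply: nd; exists d => // p Gp.
  by rewrite leNgt; apply/negP => pd; apply: nh; exists p.
(* Extending the zero functional with [B = 1] gives [G] vanishing on the graph with
   [Re (G (x, y)) >= d]. *)
have [|||||G [Glin Gc G0 Gz]] := @hahn_banach_extension _ _ (graph iotap)
  (fun=> 0) 1 (x, y).
- by split => /=; [exact: dom0|rewrite op0].
- move=> a [p1 p2] [q1 q2] [/= Dp ->] [/= Dq ->].
  by split => /=; [exact: domP|rewrite opfunP].
- by move=> a p q _ _; rewrite mulr0 addr0.
- exact: ler01.
- by move=> p _; rewrite nrm0 mul1r nrm_ge0.
have Gxy : d <= complex.Re (G (x, y)).
  by apply: Gz => p /dP; rewrite mul1r addr0.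
have GD p q : G (p + q) = G p + G q.
  by have := Glin 1 p q; rewrite scale1r mul1r.
have Gsplit p q : G (p, q) = G (p, 0) + G (0, q).
  by rewrite -GD; congr G; congr pair; rewrite ?addr0 ?add0r.
have [u _ uE] : exists2 u, setT u &
    (fun f => pairing u f) = (fun f => conjC (G (f, 0))).
  case: (form_antidual_left dual_pair) => -[_ _ surj] _.
  apply: surj; apply: (@antidual_conj _ _ (fun f => G (f, 0))).
    move=> a f g; rewrite -Glin; congr G.
    by apply/eqP; rewrite xpair_eqE /= scaler0 addr0 !eqxx.
  move=> f.
  have pair_cont : {for f, continuous (fun f : Xp => (f, 0 : X0))}.
    by apply: cvg_pair; [exact: cvg_id|exact: cvg_cst].
  exact: (@continuous_comp _ _ R[i]^o _ G _ pair_cont (Gc _)).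
have [k kE] : exists k, forall h, G (0, h) = ip h k.
  apply: (riesz_representation ipH).
    move=> a f g; rewrite -Glin; congr G.
    by apply/eqP; rewrite xpair_eqE /= scaler0 addr0 !eqxx.
  move=> f.
  have pair_cont : {for f, continuous (fun f : X0 => (0 : Xp, f))}.
    by apply: cvg_pair; [exact: cvg_cst|exact: cvg_id].
  exact: (@continuous_comp _ _ R[i]^o _ G _ pair_cont (Gc _)).
have kpair f : dom iotap f -> ip k (iotap f) = - pairing u f.
  move=> Df; have := G0 (f, iotap f); rewrite Gsplit kE => /(_ (conj Df erefl)).
  move=> /eqP; rewrite addrC addr_eq0 => /eqP h.
  rewrite (ipC ip) h; have := congr1 (fun a => a f) uE => /= ->.
  by rewrite rmorphN.
have [M M0 hM] := pairing_bound dual_pair.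
(* By [kpair], [f |-> <k, iotap f>] is bounded by [M |u| |f|]. *)
have [v Dv vk] : ran iotam k.
  apply: adjE; apply: (@bounded_adjoint_dom _ _ _ _ _ _ (M * nrm u)) => f Df.
  by rewrite kpair// nrmN -mulrA.
have uv : pairing u x = pairing (- v) x.
  apply: pairing_eq_on_dom => f Df.
  by rewrite linearNl (pairingE Df Dv) vk kpair// opprK.
(* [conj (G (x, 0)) = pairing u x = - <iotam v, y> = - <k, y>], so [G (x, 0)] cancels
   [G (0, y) = <y, k>]. *)
have : G (x, y) = 0.
  rewrite Gsplit kE; have /= := congr1 (fun a => a x) uE.
  rewrite uv linearNl pxE// vk => /(congr1 conjC); rewrite conjCK => <-.
  by rewrite rmorphN /= -(ipC ip) addNr.
by move=> G_eq0; move: Gxy; rewrite G_eq0 /=; lra.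
Qed.

(** The variational inequality bounds [Re <g, iotap x>] by [c = Re <g, y>] on the ball of radius
    [e]; rescaling yields the bound [c / e], doubled to include the imaginary part. *)
Lemma projection_in_adjoint_dom (e : R) (K : set X0) (f y : X0) : 0 < e ->
  (forall x, dom iotap x -> nrm x <= e -> K (iotap x)) ->
  (forall z, K z -> complex.Re (ip (f - y) (z - y)) <= 0) ->
  adjoint_dom iotap ip (f - y).
Proof.
move=> e0 KP yP; set g := f - y; pose c := complex.Re (ip g y).
have Re_c x : dom iotap x -> nrm x <= e -> complex.Re (ip g (iotap x)) <= c.
  move=> Dx xe; have := yP _ (KP x Dx xe).
  by rewrite linearBr cReD cReN /c; lra.
have Re_le x : dom iotap x -> complex.Re (ip g (iotap x)) <= c / e * nrm x.
  move=> Dx; have [->|/nrm_gt0 x0] := eqVneq x 0.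
    by rewrite op0 linear0r nrm0 mulr0.
  have := Re_c ((e / nrm x)%:C *: x) (domZ _ Dx).
  rewrite nrmZr gtr0_norm ?divr_gt0// divfK ?gt_eqF// lexx => /(_ isT).
  rewrite opZ// linearZr_LR /= conjC_real_complex cReZ.
  rewrite -ler_pdivlMl ?divr_gt0// invf_div.
  by rewrite (_ : nrm x / e * c = c / e * nrm x)//; ring.
apply: (@bounded_adjoint_dom _ _ _ _ _ _ (2 * (c / e))) => x Dx.
apply: le_trans (nrm_le_ReIm _) _.
have Im x' : dom iotap x' ->
    complex.Im (ip g (iotap x')) = complex.Re (ip g (iotap ('i%C *: x'))).
  move=> Dx'; rewrite opZ// linearZr_LR /=.
  by case: (ip g _) => a b /=; lra.
have abs_le x' : dom iotap x' ->
    `|complex.Re (ip g (iotap x'))| <= c / e * nrm x'.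
  move=> Dx'; rewrite ler_norml Re_le// andbT.
  have := Re_le _ (domZ (-1) Dx').
  by rewrite opZ// !scaleN1r linearNr cReN nrmN; lra.
have := abs_le x Dx; have := abs_le _ (domZ 'i%C Dx).
rewrite nrmZi -Im//; lra.
Qed.

(** Each [u] imposes a closed condition, as [y |-> ip (iotam u) y] is continuous by [ip_le]. *)
Lemma ran_iotam_bounded_closed (e : R) : closed [set y |
  forall u, dom iotam u -> nrm (ip (iotam u) y) <= e * nrm u].
Proof.
apply/closedP => y yK u Du; apply/ler_addgt0Pr => s s0.
set w := iotam u.
have D0 : 0 < 2 * nrm w + 1 by rewrite ltr_wpDl// mulr_ge0// nrm_ge0.
have [a /(_ u Du) Ka] := yK _ (divr_gt0 s0 D0).
rewrite ltr_pdivlMr// => ya.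
have := ip_le ipH w (y - a); rewrite linearBr => h.
have := nrmD (ip w y - ip w a) (ip w a); rewrite subrK.
have := nrm_ge0 (y - a); rewrite -/w in Ka; lra.
Qed.

Lemma small_splitting f (d : R) : ran iotap f -> 0 < d ->
  exists y, [/\ ran iotap y, ran iotam (f - y) & nrm y < d].
Proof.
move=> rf d0; have [M M0 hM] := pairing_bound dual_pair.
have d2 : 0 < d / 2 by rewrite divr_gt0.
have /denseP/(_ f _ d2)[_ [v Dv <-] fv] := dense_range embm.
have v1 : 0 < nrm v + 1 by have := nrm_ge0 v; lra.
(* Chosen so that [e |v| <= d^2 / 4]. *)
pose e := d ^+ 2 / (4 * (nrm v + 1)).
have e0 : 0 < e by rewrite divr_gt0 ?exprn_gt0 ?mulr_gt0.
pose K := [set y | forall u, dom iotam u ->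
  nrm (ip (iotam u) y) <= e * nrm u].
have K0 : K 0.
  by move=> u _; rewrite linear0r nrm0 mulr_ge0 ?nrm_ge0 ?ltW.
have convK (t : R) x y : 0 <= t <= 1 -> K x -> K y ->
    K (x + t%:C *: (y - x)).
  move=> /andP[t0 t1] Kx Ky u Du; have := Kx u Du; have := Ky u Du.
  rewrite linearDr linearZr_LR /= linearBr conjC_real_complex.
  set a := ip _ y; set b := ip _ x => ha hb.
  have -> : b + t%:C * (a - b) = (1 - t)%:C * b + t%:C * a.
    by rewrite rmorphB rmorph1; ring.
  apply: le_trans (nrmD _ _) _; rewrite !nrmM !nrm_real.
  rewrite !ger0_norm ?subr_ge0//.
  have t1' : 0 <= 1 - t by rewrite subr_ge0.
  by have := ler_wpM2l t0 ha; have := ler_wpM2l t1' hb; nra.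
have [|y Ky yP] :=
  hilbert_projection ipH f (@ran_iotam_bounded_closed e) _ convK.
  by exists 0.
have M1 : 0 < M + 1 by lra.
exists y; split.
- exact: bounded_ran_iotap (ltW e0) Ky.
(* For [|x| <= e / (M + 1)], [|<iotam u, iotap x>| = |pairing u x| <= M |u| |x| <= e |u|]. *)
- apply: adjE; apply: (@projection_in_adjoint_dom (e / (M + 1)) K) => //.
    exact: divr_gt0.
  move=> x Dx; rewrite ler_pdivlMr// => xe u Du; rewrite -pairingE//.
  apply: le_trans (hM _ _) _; have := nrm_ge0 u; have := nrm_ge0 x; nra.
(* Testing with [z = 0]: [|y|^2 <= Re <f - iotam v, y> + Re <iotam v, y> <= (d / 2) |y| + d^2 / 4],
   impossible if [|y| >= d]. *)
- have := yP 0 K0; rewrite sub0r linearNr linearBl cReN cReD cReN.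
  rewrite -(nrm_sqr ipH).
  have := Ky v Dv; have := ip_Re_le ipH (f - iotam v) y.
  have := normr_Re_le (ip (iotam v) y); rewrite ler_norml => /andP[_].
  rewrite linearBl cReD cReN => h1 h2 h3 h4.
  have h5 : e * nrm v <= d ^+ 2 / 4.
    have eE : e * (4 * (nrm v + 1)) = d ^+ 2.
      by rewrite divfK// gt_eqF// mulr_gt0.
    lra.
  rewrite ltNge; apply/negP => dy.
  have := nrm_ge0 y; nra.
Qed.

End QuasiGelfand.

Unset Implicit Arguments.

Theorem proposition4p12 (R : realType)
    (Xp X0 Xm : completeNormedModType R[i])
    (pairing : {sesquilinear Xm -> Xp -> R[i]})
    (ip : {dot X0 for conjC})
    (iotap : operator Xp X0) (iotam : operator Xm X0) :
  quasi_Gelfand_triple pairing ip iotap iotam ->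
  dense (ran iotap `&` ran iotam).
Proof.
move=> Q; apply/denseP => x e e0.
have e2 : 0 < e / 2 by rewrite divr_gt0.
have /denseP/(_ x _ e2)[f rf xf] := dense_range (pqg_embp Q.1).
have [y [ry rfy ye]] := small_splitting Q rf e2.
exists (f - y); first by split => //; exact: ranB.
by have := nrmBD f x (f - y); rewrite subKr; lra.
Qed.
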